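(* Let $n\ge0$ be an integer and let $S_n=F_nU_n^{-1}$, a linear operator on the space $\mathcal P_n$ of complex polynomials of degree at most $n$. Then $S_n$ is invertible and for every $p=0,1,\dots,n$, $$S_n^{-1}x^p=\frac{p!\,(n-p)!}{(2n)!}\sum_{m=p}^{n}\binom{-n}{m-p}\binom{2n}{n-m}x^m .$$
   Context: The Euler polynomials $A_k(x)$ are defined by $\frac{A_k(x)}{(1-x)^{k+1}}=\sum_{m\ge0}m^kx^m$, with $A_0=1$. Linear operators on $\mathcal P_n$ are given on monomials $x^p$, $p=0,\dots,n$: $U_n x^p=\frac1{n!}(1-x)^{n-p}A_p(x)=(1-x)^{n+1}\frac1{n!}\sum_{m\ge0}m^px^m$ (invertible, with $U_n^{-1}x^p=(x)_p[x+1]_{n-p}$, where $(\varphi)_k=\varphi(\varphi-1)\cdots(\varphi-k+1)$, $[\varphi]_k=\varphi(\varphi+1)\cdots(\varphi+k-1)$, both $=1$ for $k=0$); $F_n x^p=(1-x)^{2n+1}\sum_{m\ge0}m^p\binom{m+n}{n}x^m$ (a polynomial of degree $\le n$; $0^0=1$). Binomial coefficients with negative upper entry are $\binom{c}{k}=c(c-1)\cdots(c-k+1)/k!$. *)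

(* Defs.v *)
From HB Require Import structures.
From mathcomp Require Import all_boot all_order all_algebra.
From mathcomp Require Import ring.

Set Implicit Arguments.
Unset Strict Implicit.
Unset Printing Implicit Defensive.

Import GRing.Theory Num.Theory.
Local Open Scope ring_scope.

Section FormalSeries.
Variable K : comNzRingType.
Implicit Types (p q : {poly K}) (a b : nat -> K).

(* A formal power series is given by its coefficient sequence [a : nat -> K];
   [mulps p a] is the sequence of coefficients of the product of the
   polynomial [p] and the series [a]. *)
Definition mulps p a : nat -> K :=
  fun k => \sum_(i < k.+1) p`_i * a (k - i)%N.

Lemma mulps_trunc p a N k (A : {poly K}) :
  (forall i, (i < N)%N -> A`_i = a i) -> (k < N)%N ->
  mulps p a k = (p * A)`_k.
Proof.
move=> hA ltkN; rewrite coefM; apply: eq_bigr => i _.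
by rewrite hA // (leq_ltn_trans (leq_subr _ _)).
Qed.

Lemma coef_trunc a N i : (i < N)%N -> (\poly_(j < N) a j)`_i = a i.
Proof. by move=> h; rewrite coef_poly h. Qed.

Lemma mulpsA p q a k : mulps (p * q) a k = mulps p (mulps q a) k.
Proof.
rewrite (mulps_trunc _ (@coef_trunc a k.+1)) // -mulrA.
rewrite (@mulps_trunc _ _ k.+1 _ (q * \poly_(j < k.+1) a j)) // => i lti.
by rewrite (mulps_trunc _ (@coef_trunc a k.+1)).
Qed.

Lemma eq_mulps p a b : a =1 b -> mulps p a =1 mulps p b.
Proof. by move=> h k; apply: eq_bigr => i _; rewrite h. Qed.

Lemma mulps1 a : mulps 1 a =1 a.
Proof.
by move=> k; rewrite (mulps_trunc _ (@coef_trunc a k.+1)) // mul1r coef_trunc.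
Qed.

Lemma mulps_1subX a k :
  mulps (1 - 'X) a k = a k - (if k is k'.+1 then a k' else 0).
Proof.
rewrite (mulps_trunc _ (@coef_trunc a k.+1)) // mulrBl mul1r coefB coefXM.
by rewrite coef_trunc //; case: k => [|k] //=; rewrite coef_trunc.
Qed.

Lemma mulpsXn p a n k :
  mulps p (fun k => if (k < n)%N then 0 else a (k - n)%N) k =
  if (k < n)%N then 0 else mulps p a (k - n)%N.
Proof.
pose A := \poly_(j < k.+1) a j.
rewrite (@mulps_trunc _ _ k.+1 _ ('X^n * A)) //; last first.
  move=> i lti; rewrite coefXnM; case: ifP => // _.
  by rewrite coef_trunc // (leq_ltn_trans (leq_subr _ _)).
rewrite mulrCA coefXnM; case: ifP => // _.
rewrite (@mulps_trunc _ _ k.+1 _ A) //; first by move=> *; apply: coef_trunc.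
by rewrite ltnS leq_subr.
Qed.

Lemma size_backdiff q d : (size q <= d.+1)%N ->
  (size (q - (q \Po ('X - 1)))%R <= d)%N.
Proof.
elim/poly_ind: q d => [|q c IH] d; first by rewrite -polyC0 comp_polyC subrr size_poly0.
have [->|q0] := eqVneq q 0.
  by rewrite mul0r add0r comp_polyC subrr size_poly0.
rewrite size_MXaddC (negPf q0) /= ltnS => sq.
rewrite comp_poly_MXaddC.
have -> : q * 'X + c%:P - ((q \Po ('X - 1)) * ('X - 1) + c%:P)
          = (q - (q \Po ('X - 1))) * ('X - 1) + q by ring.
rewrite (leq_trans (size_polyD _ _)) // geq_max sq andbT.
case: d sq => [|d] sq; first by rewrite leqn0 size_poly_eq0 (negPf q0) in sq.
rewrite (leq_trans (size_polyMleq _ _)) //.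
by rewrite -[1]/(1%:P) size_XsubC addn2 /= ltnS IH.
Qed.

(* For [q] of degree < d, the series [sum_k q(k - c) x^k] has denominator
   dividing (1-x)^d. *)
Lemma mulps_horner d q (c : K) k : (size q <= d)%N -> (d <= k)%N ->
  mulps ((1 - 'X) ^+ d) (fun k => q.[k%:R - c]) k = 0.
Proof.
suff H N a : (size q <= d)%N -> (forall k, (N <= k)%N -> a k = q.[k%:R - c]) ->
  (N + d <= k)%N -> mulps ((1 - 'X) ^+ d) a k = 0 by move=> *; apply: (H 0%N).
elim: d N a q => [|d IH] N a q sq ha ltk.
  rewrite expr0 mulps1 ha ?(leq_trans _ ltk) ?leq_addr //.
  by move: sq; rewrite leqn0 size_poly_eq0 => /eqP->; rewrite horner0.
rewrite exprSr mulpsA; apply: (IH N.+1 _ _ (size_backdiff sq)); last first.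
  by rewrite addSnnS.
case=> // k' lek; rewrite mulps_1subX !ha ?(leq_trans _ lek) //.
rewrite hornerD hornerN horner_comp !hornerE -natr1.
by congr (_ - q.[_]); ring.
Qed.

End FormalSeries.

Section Operators.
Variable K : numFieldType.

Lemma npolypX n (p : 'I_n.+1) : npolyp n.+1 'X^p = 'X^p :> {poly K}.
Proof. by rewrite npolypK // size_polyXn. Qed.

(* Euler polynomials: A_k(x) / (1-x)^{k+1} = sum_m m^k x^m.  Cutting the
   series off at degree k loses nothing: see [coef_euler_poly]. *)
Definition euler_poly (k : nat) : {poly K} :=
  \poly_(j < k.+1) mulps ((1 - 'X) ^+ k.+1) (fun m => m%:R ^+ k) j.

Lemma coef_euler_poly k j :
  (euler_poly k)`_j = mulps ((1 - 'X) ^+ k.+1) (fun m => m%:R ^+ k) j.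
Proof.
rewrite coef_poly; case: ltnP => // ltkj.
rewrite (@eq_mulps _ _ _ (fun m => ('X^k).[m%:R - 0])).
  by rewrite mulps_horner ?size_polyXn.
by move=> m; rewrite subr0 hornerXn.
Qed.

Definition ext_monomials (n : nat) (v : 'I_n.+1 -> {poly_n.+1 K})
    (f : {poly_n.+1 K}) : {poly_n.+1 K} :=
  \sum_(p < n.+1) (f : {poly K})`_p *: v p.

Fact ext_monomials_linear n v : linear (@ext_monomials n v).
Proof.
move=> c f g; rewrite /ext_monomials scaler_sumr -big_split; apply: eq_bigr => p _.
by rewrite /= coefD coefZ scalerDl scalerA.
Qed.
HB.instance Definition _ n v := GRing.isLinear.Build K {poly_n.+1 K}
  {poly_n.+1 K} _ (@ext_monomials n v) (@ext_monomials_linear n v).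

Lemma ext_monomialsX n v (p : 'I_n.+1) : @ext_monomials n v (npolyp n.+1 'X^p) = v p.
Proof.
rewrite /ext_monomials (bigD1 p) //= npolypX coefXn eqxx scale1r big1 ?addr0 //.
by move=> i neqip; rewrite coefXn (_ : (i == p :> nat) = false) ?scale0r //; apply: negPf.
Qed.

(* U_n x^p = (1-x)^{n-p} A_p(x) / n!; [npolyp n.+1] does not truncate it: see
   [U_op_X], and [coef_U_op_X] for the series form. *)
Definition U_op (n : nat) : 'End({poly_n.+1 K}) :=
  linfun (ext_monomials (fun p : 'I_n.+1 =>
    npolyp n.+1 ((n`!%:R)^-1 *: ((1 - 'X) ^+ (n - p) * euler_poly p)))).

(* F_n x^p = (1-x)^{2n+1} sum_m m^p C(m+n,n) x^m.  Cutting the series off at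
   degree n loses nothing: see [coef_F_op_X]. *)
Definition F_op (n : nat) : 'End({poly_n.+1 K}) :=
  linfun (ext_monomials (fun p : 'I_n.+1 =>
    mk_npoly n.+1 (mulps ((1 - 'X) ^+ (2 * n).+1)
      (fun m => m%:R ^+ p * 'C(m + n, n)%:R)))).

(* [(U_op n)^-1] is a two-sided inverse: see [U_op_bij] and [U_op_invX]. *)
Definition S_op (n : nat) : 'End({poly_n.+1 K}) :=
  (F_op n \o (U_op n)^-1)%VF.

Definition gbinom (c : K) (k : nat) : K :=
  (\prod_(i < k) (c - i%:R)) / k`!%:R.

Lemma U_op_X n (p : 'I_n.+1) : U_op n (npolyp n.+1 'X^p) =
  (n`!%:R)^-1 *: ((1 - 'X) ^+ (n - p) * euler_poly p) :> {poly K}.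
Proof.
rewrite lfunE /= ext_monomialsX npolypK //.
have lepn : (p <= n)%N by rewrite -ltnS.
rewrite (leq_trans (size_scale_leq _ _)) // (leq_trans (size_polyMleq _ _)) //.
have s1 : (size ((1 - 'X : {poly K}) ^+ (n - p)) <= (n - p).+1)%N.
  rewrite (leq_trans (size_poly_exp_leq _ _)) // ltnS.
  by rewrite -size_polyN opprB -[1]/(1%:P) size_XsubC mul1n.
have s2 : (size (euler_poly p) <= p.+1)%N by apply: size_poly.
rewrite -subn1 leq_subLR (leq_trans (leq_add s1 s2)) //.
by rewrite addSn addnS subnK.
Qed.

Lemma coef_U_op_X n (p : 'I_n.+1) j : (U_op n (npolyp n.+1 'X^p) : {poly K})`_j =
  (n`!%:R)^-1 * mulps ((1 - 'X) ^+ n.+1) (fun m => m%:R ^+ p) j.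
Proof.
rewrite U_op_X coefZ; congr (_ * _).
have e : n.+1 = (n - p + p.+1)%N by rewrite addnS subnK // -ltnS.
have -> : (1 - 'X : {poly K}) ^+ n.+1 = (1 - 'X) ^+ (n - p + p.+1) by rewrite -e.
rewrite exprD mulpsA (@mulps_trunc _ _ _ j.+1 _ (euler_poly p)) // => i _.
exact: coef_euler_poly.
Qed.

Lemma natr_ffact m k :
  \prod_(i < k) (m%:R - i%:R) = (m ^_ k)%:R :> K.
Proof.
elim: k => [|k IH]; first by rewrite big_ord0 ffactn0.
rewrite big_ord_recr /= IH ffactnSr natrM.
by case: (leqP k m) => [/natrB->//|ltmk]; rewrite ffact_small // !mul0r.
Qed.

Lemma coef_F_op_X n (p : 'I_n.+1) j : (F_op n (npolyp n.+1 'X^p) : {poly K})`_j =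
  mulps ((1 - 'X) ^+ (2 * n).+1) (fun m => m%:R ^+ p * 'C(m + n, n)%:R) j.
Proof.
rewrite lfunE /= ext_monomialsX coef_poly; case: ltnP => // ltnj.
have nz : n`!%:R != 0 :> K by rewrite pnatr_eq0 -lt0n fact_gt0.
set a := fun m => _; rewrite -[j](addnK n).
have := mulpsXn ((1 - 'X) ^+ (2 * n).+1) a n (j + n).
rewrite ltnNge leq_addl /= => <-.
pose q := (n`!%:R)^-1 *: ('X^p * \prod_(i < n) ('X + (n%:R - i%:R)%:P)) : {poly K}.
rewrite (@eq_mulps _ _ _ (fun k => q.[k%:R - n%:R])).
  rewrite mulps_horner //; last by rewrite mul2n -addnn -addSn leq_add2r.
  rewrite (leq_trans (size_scale_leq _ _)) // (leq_trans (size_polyMleq _ _)) //.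
  rewrite size_polyXn addSn /= (@eq_bigr _ _ _ _ _ _ _
    (fun i : 'I_n => 'X - (i%:R - n%:R)%:P)); last first.
    by move=> i _; rewrite -[_ - n%:R]opprB polyCN opprK.
  rewrite size_prod_XsubC /index_enum -enumT size_enum_ord.
  by rewrite mul2n -addnn addnS ltnS leq_add2r -ltnS.
move=> k; rewrite hornerZ hornerM hornerXn horner_prod.
rewrite (eq_bigr (fun i : 'I_n => k%:R - i%:R)); last first.
  by move=> i _; rewrite hornerD hornerX hornerC; ring.
rewrite natr_ffact; case: ltnP => [ltkn|lenk].
  by rewrite ffact_small // !mulr0.
by rewrite /a natrB // subnK // -bin_ffact natrM mulrCA mulrA; field.
Qed.

Lemma mulps_bin n p j :
  mulps ((1 - 'X) ^+ n.+1)
    (fun m => if (m < p)%N then 0 else 'C(m - p + n, n)%:R) j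
  = ('X^p : {poly K})`_j.
Proof.
rewrite (mulpsXn ((1 - 'X) ^+ n.+1) (fun m => 'C(m + n, n)%:R)) coefXn.
have H k : mulps ((1 - 'X : {poly K}) ^+ n.+1) (fun m => 'C(m + n, n)%:R) k
    = (k == 0%N)%:R.
  elim: n k => [|n IH] k.
    rewrite expr1 mulps_1subX; case: k => [|k]; rewrite !bin0 ?subr0 //.
    by rewrite subrr.
  rewrite exprSr mulpsA -IH; apply: eq_mulps => -[|m].
    by rewrite mulps_1subX subr0 !add0n !binn.
  by rewrite mulps_1subX -[(m + n.+1)%N]addSnnS [(m.+1 + n.+1)%N]addnS binS natrD addrAC subrr add0r.
case: ltnP => [ltjp|lepj]; first by rewrite ltn_eqF.
by rewrite H subn_eq0 eqn_leq lepj andbT.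
Qed.

Definition U_inv_poly n p : {poly K} :=
  \prod_(i < p) ('X - i%:R%:P) * \prod_(i < n - p) ('X + 1 + i%:R%:P).

Lemma size_U_inv_poly n (p : 'I_n.+1) : (size (U_inv_poly n p) <= n.+1)%N.
Proof.
rewrite (leq_trans (size_polyMleq _ _)) // size_prod_XsubC.
rewrite (eq_bigr (fun i : 'I_(n - p) => 'X - (- (1 + i%:R))%:P)); last first.
  by move=> i _; rewrite polyCN opprK polyCD polyC1 addrA.
rewrite size_prod_XsubC /index_enum -!enumT !size_enum_ord addSn /= addnS.
by rewrite subnKC // -ltnS.
Qed.

Lemma horner_U_inv_poly n (p : 'I_n.+1) m : (U_inv_poly n p).[m%:R] =
  n`!%:R * (if (m < p)%N then 0 else 'C(m - p + n, n)%:R).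
Proof.
rewrite hornerM !horner_prod.
under eq_bigr do rewrite hornerXsubC.
rewrite natr_ffact; case: ltnP => [ltmp|lepm].
  by rewrite ffact_small // mul0r mulr0.
have lepn : (p <= n)%N by rewrite -ltnS.
have rise k : m`!%:R * \prod_(i < k) ('X + 1 + i%:R%:P).[m%:R] = (m + k)`!%:R :> K.
  elim: k => [|k IH]; first by rewrite big_ord0 mulr1 addn0.
  rewrite big_ord_recr mulrA IH addnS factS natrM mulrC !hornerE.
  by congr (_ * _); rewrite -natr1 natrD; ring.
have nz : (m - p)`!%:R != 0 :> K by rewrite pnatr_eq0 -lt0n fact_gt0.
apply: (mulfI nz); rewrite mulrA -!natrM [((m - p)`! * m ^_ p)%N]mulnC ffact_fact // rise.
congr (_%:R).
have -> : (m + (n - p) = m - p + n)%N by rewrite addnBA // addnBAC.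
rewrite -(bin_fact (leq_addl (m - p) n)) addnK.
by rewrite [RHS]mulnC [(n`! * 'C(_, _))%N]mulnC mulnA.
Qed.

Lemma U_op_inv_poly n (p : 'I_n.+1) :
  U_op n (npolyp n.+1 (U_inv_poly n p)) = npolyp n.+1 'X^p.
Proof.
apply: val_inj; apply/polyP => j.
set f := npolyp _ _.
have fE : f = \sum_(i < n.+1) (f : {poly K})`_i *: npolyp n.+1 'X^i.
  apply: val_inj; rewrite [LHS](npolyX_gen (size_npoly f)) /= !raddf_sum /=.
  by apply: eq_bigr => i _; rewrite tnth_map tnth_ord_tuple.
rewrite {1}fE linear_sum /= raddf_sum coef_sum.
under eq_bigr => i _ do rewrite linearZ /= coefZ coef_U_op_X.
rewrite npolypX -(mulps_bin n p j).
under eq_bigr => i _ do rewrite mulrCA.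
rewrite -mulr_sumr.
under eq_bigr => i _ do rewrite mulr_sumr.
rewrite exchange_big mulr_sumr; apply: eq_bigr => i _ /=.
under eq_bigr => k _ do rewrite mulrCA.
rewrite -mulr_sumr mulrCA; congr (_ * _).
have nz : n`!%:R != 0 :> K by rewrite pnatr_eq0 -lt0n fact_gt0.
apply: (mulfI nz); rewrite mulVKf // -horner_U_inv_poly.
rewrite /f npolypK ?size_U_inv_poly //.
by rewrite -(horner_coef_wide _ (size_U_inv_poly p)).
Qed.

Lemma U_op_lker0 n : lker (U_op n) == 0%VS.
Proof.
have full : limg (U_op n) = fullv.
  apply/eqP; rewrite eqEsubv subvf /= -[X in (X <= _)%VS](span_basis (npolyX_full K n.+1)).
  apply/span_subvP => x /tnthP[i ->]; rewrite tnth_map tnth_ord_tuple -U_op_inv_poly.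
  exact: memv_img (memvf _).
have := limg_ker_dim (U_op n) fullv; rewrite full capfv => /eqP.
by rewrite -[X in _ == X]add0n eqn_add2r dimv_eq0.
Qed.

Lemma U_op_bij n : bijective (U_op n).
Proof.
by exists (U_op n)^-1%VF; [exact: lker0_lfunK (U_op_lker0 n)
                         | exact: lker0_lfunVK (U_op_lker0 n)].
Qed.

Lemma U_op_invX n (p : 'I_n.+1) :
  (U_op n)^-1%VF (npolyp n.+1 'X^p) = U_inv_poly n p :> {poly K}.
Proof.
by rewrite -U_op_inv_poly lker0_lfunK ?U_op_lker0 // npolypK // size_U_inv_poly.
Qed.

End Operators.

(* Main.v *)
(* [U_n^-1 f] takes at k the value n! times the k-th coefficient of
   [f / (1-x)^(n+1)], so S_n multiplies this coefficient by [n! C(k+n,n)] and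
   changes the denominator to [(1-x)^(2n+1)].  Evaluating
   the [U_n^-1]-image of the claimed inverse at t gives the terminating
   Saalschutz sum 3F2(n, p-t, -(n-p); n+p+1, -n-t+p; 1), whose closed form
   turns it, after multiplication by C(k+n,n), into C(k-p+2n,2n), the k-th
   coefficient of [x^p / (1-x)^(2n+1)]. *)

Require Import Defs.
From mathcomp Require Import all_boot all_order all_algebra.
From mathcomp Require Import reals complex.
From mathcomp Require Import ring zify.

Set Implicit Arguments.
Unset Strict Implicit.

Import GRing.Theory.
Local Open Scope ring_scope.

(** * Rising factorials and Saalschutz's summation *)

Section RisingFactorial.
Variable A : comPzRingType.
Implicit Types a b c t : A.

Definition rising a k : A := \prod_(i < k) (a + i%:R).

Lemma rising0 a : rising a 0 = 1.
Proof. exact: big_ord0. Qed.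

Lemma risingSr a k : rising a k.+1 = rising a k * (a + k%:R).
Proof. exact: big_ord_recr. Qed.

Lemma risingD a k l : rising a (k + l) = rising a k * rising (a + k%:R) l.
Proof.
elim: l => [|l IH]; first by rewrite addn0 rising0 mulr1.
by rewrite addnS !risingSr IH natrD addrA mulrA.
Qed.

Lemma risingS a k : rising a k.+1 = a * rising (a + 1) k.
Proof. by rewrite -add1n risingD risingSr rising0 mul1r addr0. Qed.

Lemma risingN a k : \prod_(i < k) (a - i%:R) = (-1) ^+ k * rising (- a) k.
Proof.
elim: k => [|k IH]; first by rewrite rising0 big_ord0 mulr1.
by rewrite big_ord_recr risingSr /= IH exprSr; ring.
Qed.

Lemma rising_natr m k : m`!%:R * rising m.+1%:R k = (m + k)`!%:R :> A.
Proof.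
elim: k => [|k IH]; first by rewrite rising0 mulr1 addn0.
by rewrite risingSr mulrA IH addnS factS [RHS]natrM mulrC -natrD addSn.
Qed.

(* Denominators are cleared, so that the summation holds in any commutative
   ring. *)
Definition saal_term N a b c j : A :=
  'C(N, j)%:R * rising a j * rising b j
    * rising (c - a - b) (N - j) * rising (c + j%:R) (N - j).

(* Zeilberger certificate for the recurrence in [N]. *)
Definition saal_cert N a b c j : A :=
  if j is i.+1 then
    - ('C(N, i)%:R * rising a j * rising b j
       * rising (c - a - b) (N - i) * rising (c + i%:R) (N - i))
  else 0.

Lemma saal_telescope N a b c j : (j <= N.+1)%N ->
  saal_term N.+1 a b c j
    - (c - a + N%:R) * (c - b + N%:R) * saal_term N a b c j
  = saal_cert N a b c j.+1 - saal_cert N a b c j.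
Proof.
(* At j = N+1 the truncated [N - j] is 0, but C(N, N+1) = 0 removes the terms where this matters. *)
rewrite leq_eqVlt => /predU1P[->|].
  rewrite /saal_term /saal_cert !subnn !subnS subnn binn bin_small // binn.
  by rewrite !rising0; ring.
rewrite ltnS => /subnKC; set M := (N - j)%N => eqN.
have eN1 : (N.+1 - j = M.+1)%N by rewrite -eqN -addnS addKn.
case: j @M eqN eN1 => [|i] M eqN eN1; rewrite /saal_term /saal_cert.
  rewrite !subn0 !bin0 !risingSr !rising0; ring.
have eNi : (N - i = M.+1)%N by rewrite -eqN addSnnS addKn.
rewrite eN1 eNi -/M [rising (c + i%:R) _]risingS !risingSr.
have -> : c + i%:R + 1 = c + i.+1%:R by rewrite -natr1 addrA.
rewrite binS natrD.
have eB : 'C(N, i)%:R * (M%:R + 1) = (i%:R + 1) * 'C(N, i.+1)%:R :> A.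
  by rewrite !natr1 -!natrM mul_bin_left eNi mulnC.
have -> : N%:R = i%:R + 1 + M%:R :> A by rewrite natr1 -natrD eqN.
rewrite -[i.+1%:R]natr1.
move: eB; set B := 'C(N, i)%:R; set B' := 'C(N, i.+1)%:R => eB.
apply/eqP; rewrite -subr_eq0; apply/eqP.
set X := rising (c - a - b) M; set Y := rising (c + _) M.
set Z := rising a i; set W := rising b i.
(* With [B] and [B'] treated as independent, the difference of the two sides is an explicit multiple
   of the relation [eB]. *)
transitivity ((B * (M%:R + 1) - (i%:R + 1) * B')
   * (Z * (a + i%:R) * (W * (b + i%:R)) * X * Y * (c - a - b + M%:R))); last first.
  by rewrite eB subrr mul0r.
ring.
Qed.

(** Division by (c)_N (c-a-b)_N would give 3F2(a, b, -N; c, 1+a+b-c-N; 1). Summing [saal_telescope]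
    over j shows that raising N by one multiplies the sum by (c-a+N)(c-b+N). *)
Lemma saalschutz N a b c :
  \sum_(j < N.+1) saal_term N a b c j = rising (c - a) N * rising (c - b) N.
Proof.
elim: N => [|N IH].
  by rewrite big_ord1 /saal_term bin0 !rising0 !mulr1.
rewrite !risingSr mulrACA -IH [LHS](eq_bigr (fun j : 'I_N.+2 =>
  (c - a + N%:R) * (c - b + N%:R) * saal_term N a b c j
  + (saal_cert N a b c j.+1 - saal_cert N a b c j))); last first.
  by move=> j _; rewrite -saal_telescope -1?ltnS // addrC subrK.
rewrite big_split /= -mulr_sumr big_ord_recr /=.
rewrite (_ : saal_term _ _ _ _ N.+1 = 0); last first.
  by rewrite /saal_term bin_small // !mul0r.
rewrite addr0 -(big_mkord xpredT (fun j =>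
  saal_cert N a b c j.+1 - saal_cert N a b c j)).
(* Both ends vanish: [saal_cert] is 0 at 0, and at N+2 it contains C(N, N+1). *)
rewrite telescope_sumr // /saal_cert bin_small // !mul0r oppr0 !addr0.
by rewrite mulrC.
Qed.

End RisingFactorial.

(** * The inverse of S_n on monomials *)

Section InverseOfS.
Variable K : numFieldType.

Lemma factr_neq0 n : n`!%:R != 0 :> K.
Proof. by rewrite Num.Theory.pnatr_eq0 -lt0n fact_gt0. Qed.

Lemma npolyE n (f : {poly_n.+1 K}) :
  f = \sum_(i < n.+1) (f : {poly K})`_i *: npolyp n.+1 'X^i.
Proof.
apply: val_inj; rewrite [LHS](npolyX_gen (size_npoly f)) /= !raddf_sum /=.
by apply: eq_bigr => i _; rewrite tnth_map tnth_ord_tuple.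
Qed.

Lemma coef_F_op n (f : {poly_n.+1 K}) j : (F_op K n f : {poly K})`_j =
  mulps ((1 - 'X) ^+ (2 * n).+1)
    (fun m => (f : {poly K}).[m%:R] * 'C(m + n, n)%:R) j.
Proof.
rewrite {1}[f]npolyE linear_sum /= raddf_sum coef_sum.
under eq_bigr => i _ do rewrite linearZ /= coefZ coef_F_op_X mulr_sumr.
rewrite exchange_big; apply: eq_bigr => i _ /=.
rewrite (horner_coef_wide _ (size_npoly f)) mulr_suml mulr_sumr.
by apply: eq_bigr => k _; rewrite mulrCA !mulrA.
Qed.

(** Keeping t arbitrary allows the Saalschutz sum to be treated as an identity in t. *)
Lemma horner_U_inv_polyE n p (t : K) : (U_inv_poly K n p).[t] =
  \prod_(i < p) (t - i%:R) * rising (t + 1) (n - p).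
Proof.
rewrite hornerM !horner_prod; congr (_ * _); apply: eq_bigr => i _.
  by rewrite hornerXsubC.
by rewrite !hornerE.
Qed.

Definition S_inv_poly n p : {poly K} :=
  (p`!%:R * (n - p)`!%:R / (2 * n)`!%:R) *:
    \sum_(p <= m < n.+1)
      (gbinom (- n%:R) (m - p) * 'C(2 * n, n - m)%:R) *: 'X^m.

Lemma size_S_inv_poly n p : (size (S_inv_poly n p) <= n.+1)%N.
Proof.
rewrite (leq_trans (size_scale_leq _ _)) // big_nat.
elim/big_ind: _ => [|f g lef leg|m /andP[_ ltmn]].
- by rewrite size_poly0.
- by rewrite (leq_trans (size_polyD _ _)) // geq_max lef.
- by rewrite (leq_trans (size_scale_leq _ _)) // size_polyXn.
Qed.

(** Here a = n, b = p-t, c = n+p+1, so c-a-b = t+1. The binomial of -n gives (n)_j, the falling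
    factorial of t beyond its first p factors gives (p-t)_j, and C(2n, n-p-j) gives (c+j)_(n-p-j).
    The two signs (-1)^j cancel. *)
Lemma saal_termU n p j (t : K) : (p <= n)%N -> (j <= n - p)%N ->
  gbinom (- n%:R) j * 'C(2 * n, n - (j + p))%:R * (U_inv_poly K n (j + p)).[t]
  = (n - p)`!%:R^-1 * \prod_(i < p) (t - i%:R)
    * saal_term (n - p) n%:R (p%:R - t) (n + p).+1%:R j.
Proof.
move=> lepn lejN; rewrite horner_U_inv_polyE /saal_term /gbinom.
rewrite (_ : n - (j + p) = n - p - j)%N; last by rewrite addnC subnDA.
have -> : \prod_(i < j + p) (t - i%:R)
    = \prod_(i < p) (t - i%:R) * ((-1) ^+ j * rising (p%:R - t) j).
  rewrite addnC big_split_ord /=; congr (_ * _).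
  rewrite -[p%:R - t]opprB -risingN; apply: eq_bigr => i _.
  by rewrite natrD opprD addrA.
rewrite risingN opprK.
have -> : (n + p).+1%:R - n%:R - (p%:R - t) = t + 1.
  by rewrite -natr1 natrD; ring.
have e2 : 'C(2 * n, n - p - j)%:R
    = rising ((n + p).+1%:R + j%:R) (n - p - j) / (n - p - j)`!%:R :> K.
  apply: (mulIf (factr_neq0 (n - p - j))); rewrite divfK ?factr_neq0 //.
  apply: (mulIf (factr_neq0 (n + p + j))).
  rewrite -natrD addSn [RHS]mulrC rising_natr -!natrM; congr _%:R.
  have led : (n - p - j <= 2 * n)%N by lia.
  have -> : (n + p + j + (n - p - j) = 2 * n)%N by lia.
  rewrite -(bin_fact led) -mulnA.
  by have -> : (2 * n - (n - p - j) = n + p + j)%N by lia.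
have eN : 'C(n - p, j)%:R = (n - p)`!%:R / j`!%:R / (n - p - j)`!%:R :> K.
  rewrite -(bin_fact lejN) !natrM; field.
  by rewrite !factr_neq0.
rewrite e2 eN; have s2 : (-1) ^+ j * (-1) ^+ j = 1 :> K.
  by rewrite -exprMn mulrNN mulr1 expr1n.
transitivity (((-1) ^+ j * (-1) ^+ j) *
  (rising n%:R j * rising (p%:R - t) j * rising (t + 1) (n - p - j)
   * rising ((n + p).+1%:R + j%:R) (n - p - j) * \prod_(i < p) (t - i%:R)
   / j`!%:R / (n - p - j)`!%:R)).
  by field; rewrite !factr_neq0.
by rewrite s2; field; rewrite !factr_neq0.
Qed.

Lemma sum_U_inv_poly n p (t : K) : (p <= n)%N ->
  \sum_(p <= m < n.+1)
    gbinom (- n%:R) (m - p) * 'C(2 * n, n - m)%:R * (U_inv_poly K n m).[t]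
  = n`!%:R / (p`!%:R * (n - p)`!%:R) * \prod_(i < p) (t - i%:R)
    * rising (t + 1 + n%:R) (n - p).
Proof.
move=> lepn; rewrite -{1}[p]add0n big_addn big_mkord subSn //.
under eq_bigr => j _ do rewrite addnK saal_termU // -1?ltnS //.
rewrite -mulr_sumr saalschutz.
have -> : (n + p).+1%:R - n%:R = p.+1%:R :> K by rewrite -addnS natrD addrC addKr.
have -> : (n + p).+1%:R - (p%:R - t) = t + 1 + n%:R.
  by rewrite -natr1 natrD; ring.
have <- : p`!%:R * rising p.+1%:R (n - p) = n`!%:R :> K.
  by rewrite rising_natr subnKC.
by field; rewrite !factr_neq0.
Qed.

Lemma S_op_inv_poly n p : (p <= n)%N ->
  S_op K n (npolyp n.+1 (S_inv_poly n p)) = npolyp n.+1 'X^p.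
Proof.
move=> lepn.
have -> : npolyp n.+1 (S_inv_poly n p) =
    (p`!%:R * (n - p)`!%:R / (2 * n)`!%:R) *: \sum_(p <= m < n.+1)
      (gbinom (- n%:R) (m - p) * 'C(2 * n, n - m)%:R) *: npolyp n.+1 'X^m.
  apply: val_inj => /=; rewrite raddf_sum /=.
  rewrite [RHS](_ : _ = S_inv_poly n p); last first.
    congr (_ *: _); apply: eq_big_nat => m /andP[_ ltmn].
    by rewrite /= npolypK // size_polyXn.
  by rewrite npolypK // size_S_inv_poly.
apply: val_inj; apply/polyP => j.
rewrite lfunE /= linearZ linear_sum /= coef_F_op.
rewrite [in RHS]npolypK ?size_polyXn //.
have ltp2n : (p < (2 * n).+1)%N by lia.
(* Writing x^p over the denominator (1-x)^(2n+1) reduces the claim to a comparison of series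
   coefficients. *)
rewrite -(mulps_bin _ (2 * n)); apply: eq_mulps => k.
rewrite hornerZ raddf_sum /= horner_sum.
rewrite (eq_big_nat _ _ (F2 := fun m =>
   gbinom (- n%:R) (m - p) * 'C(2 * n, n - m)%:R * (U_inv_poly K n m).[k%:R]));
  last first.
  move=> m /andP[_ ltmn]; rewrite linearZ /= hornerZ.
  by rewrite (U_op_invX K (Ordinal ltmn)).
rewrite sum_U_inv_poly //.
apply: (mulfI (factr_neq0 (2 * n))).
(* [U_inv_poly] at 2n in place of n turns (2n)! C(k-p+2n, 2n) into a product that also covers k < p,
   where it vanishes. *)
rewrite -(horner_U_inv_poly K (Ordinal ltp2n)) horner_U_inv_polyE /=.
have -> : (2 * n - p = n + (n - p))%N by lia.
(* The first n factors of (k+1)_(2n-p) are n! C(k+n, n), from F_n; the others are the rising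
   factorial in [sum_U_inv_poly]. *)
rewrite risingD.
have <- : n`!%:R * 'C(k + n, n)%:R = rising (k%:R + 1) n :> K.
  apply: (mulfI (factr_neq0 k)); rewrite natr1 rising_natr -!natrM.
  by rewrite -(bin_fact (leq_addl k n)) addnK; congr _%:R; ring.
by field; rewrite !factr_neq0.
Qed.

(** By [S_op_inv_poly] all monomials lie in the image, so S_n is onto and rank-nullity makes it
    injective. *)
Lemma S_op_lker0 n : lker (S_op K n) == 0%VS.
Proof.
have full : limg (S_op K n) = fullv.
  apply/eqP; rewrite eqEsubv subvf /=.
  rewrite -[X in (X <= _)%VS](span_basis (npolyX_full K n.+1)).
  apply/span_subvP => x /tnthP[i ->]; rewrite tnth_map tnth_ord_tuple.
  by rewrite -S_op_inv_poly -1?ltnS // memv_img ?memvf.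
have := limg_ker_dim (S_op K n) fullv; rewrite full capfv => /eqP.
by rewrite -[X in _ == X]add0n eqn_add2r dimv_eq0.
Qed.

End InverseOfS.

Theorem theorem14 (R : realType) (n : nat) :
  bijective (S_op R[i] n) /\
  forall p : nat, (p <= n)%N ->
    ((S_op R[i] n)^-1%VF (npolyp n.+1 'X^p) : {poly R[i]}) =
      (p`!%:R * (n - p)`!%:R / (2 * n)`!%:R) *:
      \sum_(p <= m < n.+1)
        (gbinom (- n%:R) (m - p) * 'C(2 * n, n - m)%:R) *: 'X^m.
Proof.
split.
  by exists (S_op R[i] n)^-1%VF; [exact: lker0_lfunK (S_op_lker0 _ n)
                                 |exact: lker0_lfunVK (S_op_lker0 _ n)].
move=> p lepn; rewrite -S_op_inv_poly // lker0_lfunK ?S_op_lker0 //.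
by rewrite npolypK ?size_S_inv_poly.
Qed.
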